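(* Let $g:\mathbb{R}^n\to\mathbb{R}$ be continuously differentiable and strongly convex with constant $m>0$, i.e. $(\nabla g(x)-\nabla g(y))^\top(x-y)\ge m\|x-y\|^2$ for all $x,y\in\mathbb{R}^n$, and let $h=0$, so $f=g$. Run the proximal nonlinear conjugate gradient algorithm described in the context with parameters satisfying $\bar\nu\le m$ and $T\le1$. Then the algorithm is equivalent to the three-term Hestenes–Stiefel method (with Armijo backtracking from initial step $1$): for every $k$, $\eta_k=\nabla g(x_k)$; for every $k\ge1$, $\nu_k=0$, $z_{k-1}=y_{k-1}=\nabla g(x_k)-\nabla g(x_{k-1})$ and $$d_k=-\nabla g(x_k)+\frac{\nabla g(x_k)^\top y_{k-1}}{d_{k-1}^\top y_{k-1}}\,d_{k-1}-\frac{\nabla g(x_k)^\top d_{k-1}}{d_{k-1}^\top y_{k-1}}\,y_{k-1};$$ and at every iteration the branching condition (B) holds with $t=1$, so that Step 4.1 is always selected.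
   Context: Notation: $\|\cdot\|$ is the Euclidean norm; for $\mu>0$, $\operatorname{prox}_{\mu h}(v)=\operatorname{argmin}_{x}\{h(x)+\frac{1}{2\mu}\|x-v\|^2\}$ (the identity when $h=0$). Algorithm (proximal nonlinear conjugate gradient method for $f=g+h$). Given $x_0\in\operatorname{dom} f$ and parameters $\mu_{-1}>0$, $\kappa,\delta,\theta,\bar t,\tau\in(0,1)$, $\bar\nu>0$, $T>\delta$. For $k=0,1,2,\dots$: Step 1. Let $\mu_k$ be the largest value in $\{\mu_{k-1},\mu_{k-1}\kappa,\mu_{k-1}\kappa^2,\dots\}$ such that $x_k^+:=\operatorname{prox}_{\mu_k h}(x_k-\mu_k\nabla g(x_k))$ satisfies $g(x_k^+)\le g(x_k)+\nabla g(x_k)^\top(x_k^+-x_k)+\frac{1}{2\mu_k}\|x_k^+-x_k\|^2$. Put $\eta_k:=-\frac{1}{\mu_k}(x_k^+-x_k)$. Step 2. Stop if $\eta_k=0$. Step 3. If $k=0$ set $d_0=-\eta_0$. If $k\ge1$ set $s_{k-1}=x_k-x_{k-1}$, $y_{k-1}=\eta_k-\eta_{k-1}$, $z_{k-1}=y_{k-1}+\nu_k s_{k-1}$, where $\nu_k=0$ if $s_{k-1}^\top y_{k-1}\ge\bar\nu\|s_{k-1}\|^2$ and $\nu_k=\max\{0,-\frac{s_{k-1}^\top y_{k-1}}{s_{k-1}^\top s_{k-1}}\}+\bar\nu$ otherwise, and $$d_k=-\eta_k+\beta_kd_{k-1}-\gamma_ky_{k-1},\quad \beta_k=\frac{\eta_k^\top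 y_{k-1}}{d_{k-1}^\top z_{k-1}},\quad \gamma_k=\frac{\eta_k^\top d_{k-1}}{d_{k-1}^\top z_{k-1}}.$$ Step 4. Consider the condition on $t>0$: (B) $t\nabla g(x_k)^\top d_k+h(x_k+td_k)-h(x_k)\le -tT\|\eta_k\|^2$. Find the largest $t\in\{1,\theta,\theta^2,\dots\}$ satisfying (B). If such a $t$ exists and $t>\bar t$, set $\alpha_{\rm init}=t$ and go to Step 4.1; otherwise go to Step 4.2. Step 4.1. Let $\alpha_k$ be the largest value in $\{\alpha_{\rm init},\tau\alpha_{\rm init},\tau^2\alpha_{\rm init},\dots\}$ with $f(x_k+\alpha_kd_k)\le f(x_k)+\delta\alpha_k\eta_k^\top d_k$; set $x_{k+1}=x_k+\alpha_kd_k$. Step 4.2. Redefine $d_k=-\eta_k$ and set $x_{k+1}=x_k^+$. The three-term Hestenes–Stiefel method for minimizing a smooth $g$ iterates $x_{k+1}=x_k+\alpha_kd_k$ with $d_0=-\nabla g(x_0)$ and $d_k$ given for $k\ge1$ by the displayed formula in the claim. All assertions are for iterations reached by the algorithm before it stops. *)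

(* Defs.v *)
From HB Require Import structures.
From mathcomp Require Import all_boot all_order all_algebra.
From mathcomp Require Import all_classical all_reals all_analysis.

Set Implicit Arguments.
Unset Strict Implicit.
Unset Printing Implicit Defensive.

Import Order.TTheory GRing.Theory Num.Theory.
Import numFieldNormedType.Exports.

Local Open Scope classical_set_scope.
Local Open Scope ring_scope.

Section Euclidean.
Context {R : realType} {n : nat}.
Implicit Types (u v : 'rV[R]_n) (g : 'rV[R]_n -> R).

Definition dot u v : R := \sum_(i < n) u 0 i * v 0 i.

(* The library norm `|v| on row vectors is the sup norm. *)
Definition enorm v : R := Num.sqrt (dot v v).

Definition grad g (x : 'rV[R]_n) : 'rV[R]_n :=
  \row_(i < n) 'D_(delta_mx 0 i) g x.

Definition continuously_differentiable g : Prop :=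
  (forall x, differentiable g x) /\ continuous (grad g).

Definition strongly_convex (m : R) g : Prop :=
  forall x y, m * enorm (x - y) ^+ 2 <= dot (grad g x - grad g y) (x - y).

(* The set of minimizers defining the proximal operator; it is a singleton
   when h is proper, closed and convex. *)
Definition prox (mu : R) (h : 'rV[R]_n -> \bar R) v : set 'rV[R]_n :=
  [set p | forall q, (h p + ((2 * mu)^-1 * enorm (p - v) ^+ 2)%:E <=
                      h q + ((2 * mu)^-1 * enorm (q - v) ^+ 2)%:E)%E].

End Euclidean.

Definition geometric_grid {R : realType} (a r : R) : set R :=
  range (fun i : nat => a * r ^+ i).

Definition is_largest {R : realType} (A : set R) (a : R) : Prop :=
  A a /\ ubound A a.

Record params (R : realType) := Params {
  mu_init : R; (* the value called mu_(-1) *)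
  kappa : R; delta : R; theta : R; tbar : R; tau : R; nubar : R; bigT : R }.

Definition in01 {R : realType} (a : R) : bool := 0 < a < 1.

Definition admissible {R : realType} (P : params R) : bool :=
  [&& 0 < mu_init P, in01 (kappa P), in01 (delta P), in01 (theta P),
      in01 (tbar P), in01 (tau P), 0 < nubar P & delta P < bigT P].

(* The history of an execution.  Entries belonging to iterations that are not
   carried out are meaningless and left unconstrained. *)
Record trace (R : realType) (n : nat) := Trace {
  iter_x : nat -> 'rV[R]_n;
  iter_mu : nat -> R;
  iter_xplus : nat -> 'rV[R]_n;
  (* the direction d_k as computed in Step 3 *)
  iter_dir : nat -> 'rV[R]_n;
  (* the direction d_k at the end of the iteration, after the possible
     redefinition of Step 4.2; this is the one used by iteration k + 1 *)
  iter_d : nat -> 'rV[R]_n;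
  iter_alpha : nat -> R }.

Section PNCG.
Context {R : realType} {n : nat}.
Variables (g : 'rV[R]_n -> R) (h : 'rV[R]_n -> \bar R) (P : params R).
Variable r : trace R n.

Local Notation x := (iter_x r).
Local Notation mu := (iter_mu r).
Local Notation xp := (iter_xplus r).
Local Notation dir := (iter_dir r).
Local Notation d := (iter_d r).
Local Notation alpha := (iter_alpha r).

Definition eta_ k : 'rV[R]_n := - ((mu k)^-1 *: (xp k - x k)).

Definition s_ k : 'rV[R]_n := x k.+1 - x k.
Definition y_ k : 'rV[R]_n := eta_ k.+1 - eta_ k.

(* Meaningful for k >= 1 only: nu_k is built from s_(k-1) and y_(k-1). *)
Definition nu_ k : R :=
  let s := s_ k.-1 in let y := y_ k.-1 in
  if nubar P * enorm s ^+ 2 <= dot s y then 0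
  else Num.max 0 (- (dot s y / dot s s)) + nubar P.

Definition z_ k : 'rV[R]_n := y_ k + nu_ k.+1 *: s_ k.

Definition beta_ k : R := dot (eta_ k) (y_ k.-1) / dot (d k.-1) (z_ k.-1).
Definition gamma_ k : R := dot (eta_ k) (d k.-1) / dot (d k.-1) (z_ k.-1).

Definition mu_prev k : R := if k is j.+1 then mu j else mu_init P.

Definition step1_accepts k (m : R) (p : 'rV[R]_n) : Prop :=
  prox m h (x k - m *: grad g (x k)) p /\
  g p <= g (x k) + dot (grad g (x k)) (p - x k)
         + (2 * m)^-1 * enorm (p - x k) ^+ 2.

Definition step1 k : Prop :=
  is_largest [set m | geometric_grid (mu_prev k) (kappa P) m /\
                      exists p, step1_accepts k m p] (mu k) /\
  step1_accepts k (mu k) (xp k).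

Definition step3 k : Prop :=
  dir k = if k is j.+1 then - eta_ k + beta_ k *: d j - gamma_ k *: y_ j
          else - eta_ 0.

Definition condB k (t : R) : Prop :=
  ((t * dot (grad g (x k)) (dir k))%:E + h (x k + t *: dir k) - h (x k) <=
   (- (t * bigT P * enorm (eta_ k) ^+ 2))%:E)%E.

Definition selects_step41 k (t : R) : Prop :=
  is_largest [set t' | geometric_grid 1 (theta P) t' /\ condB k t'] t /\
  tbar P < t.

Definition objective (v : 'rV[R]_n) : \bar R := ((g v)%:E + h v)%E.

Definition armijo k (a : R) : Prop :=
  (objective (x k + a *: d k) <=
   objective (x k) + (delta P * a * dot (eta_ k) (d k))%:E)%E.

Definition step41 k (alpha_init : R) : Prop :=
  [/\ d k = dir k,
      is_largest [set a | geometric_grid alpha_init (tau P) a /\ armijo k a]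
                 (alpha k) &
      x k.+1 = x k + alpha k *: d k].

Definition step42 k : Prop := d k = - eta_ k /\ x k.+1 = xp k.

Definition step4 k : Prop :=
  (exists2 t, selects_step41 k t & step41 k t) \/
  (~ (exists t, selects_step41 k t) /\ step42 k).

(* Iteration k is started, i.e. Step 2 did not stop any earlier iteration. *)
Definition reached k : Prop := forall j, (j < k)%N -> eta_ j != 0.

(* Iteration k goes past Step 2. *)
Definition continues k : Prop := reached k /\ eta_ k != 0.

Definition pncg_run (x0 : 'rV[R]_n) : Prop :=
  [/\ (objective x0 < +oo)%E, x 0%N = x0,
      forall k, reached k -> step1 k &
      forall k, continues k -> step3 k /\ step4 k].

End PNCG.

(* The three-term Hestenes-Stiefel method with Armijo backtracking from the
   initial step 1, stopped at the first critical iterate. *)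
Section HestenesStiefel.
Context {R : realType} {n : nat}.
Variables (g : 'rV[R]_n -> R) (delta tau : R).

Definition hs_direction (x d : nat -> 'rV[R]_n) k : 'rV[R]_n :=
  if k is j.+1 then
    let y := grad g (x k) - grad g (x j) in
    - grad g (x k)
    + (dot (grad g (x k)) y / dot (d j) y) *: d j
    - (dot (grad g (x k)) (d j) / dot (d j) y) *: y
  else - grad g (x 0%N).

Definition hs_run (x0 : 'rV[R]_n) (x d : nat -> 'rV[R]_n) (alpha : nat -> R)
    : Prop :=
  x 0%N = x0 /\
  forall k, (forall j, (j <= k)%N -> grad g (x j) != 0) ->
    [/\ d k = hs_direction x d k,
        is_largest
          [set a | geometric_grid 1 tau a /\
                   g (x k + a *: d k) <=
                   g (x k) + delta * a * dot (grad g (x k)) (d k)]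
          (alpha k) &
        x k.+1 = x k + alpha k *: d k].

End HestenesStiefel.

(* Main.v *)
(** With h = 0 the proximal step is the gradient step x - mu * grad g x, so eta_k
    is grad g x_k.  Strong convexity gives s^T y >= m |s|^2 >= nubar |s|^2, so
    nu_k = 0 and Step 3 is the three-term Hestenes-Stiefel formula, for which
    grad g x_k^T d_k = - |grad g x_k|^2.  As T <= 1 this is (B) at t = 1, which is
    the largest point of the grid.  Conversely, a Hestenes-Stiefel run extends to
    a run of the algorithm because the backtracking on mu_k always terminates:
    g decreases by at least mu/2 |grad g x_k|^2 along a short gradient step. *)

Require Import Defs.
From HB Require Import structures.
From mathcomp Require Import all_boot all_order all_algebra.
From mathcomp Require Import all_classical all_reals all_analysis.
From mathcomp Require Import ring lra.

Set Implicit Arguments.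
Unset Strict Implicit.
Unset Printing Implicit Defensive.

Import Order.TTheory GRing.Theory Num.Theory.
Import numFieldNormedType.Exports.

Local Open Scope classical_set_scope.
Local Open Scope ring_scope.

(** * Inner product algebra; the proximal operator and derivatives expressed through it *)

Section Dot.
Context {R : realType} {n : nat}.
Implicit Types (u v w : 'rV[R]_n).

Lemma dotC u v : dot u v = dot v u.
Proof. by apply: eq_bigr => i _; rewrite mulrC. Qed.

Lemma dotDl u v w : dot (u + v) w = dot u w + dot v w.
Proof. by rewrite -big_split; apply: eq_bigr => i _; rewrite mxE mulrDl. Qed.

Lemma dotZl a u v : dot (a *: u) v = a * dot u v.
Proof. by rewrite mulr_sumr; apply: eq_bigr => i _; rewrite mxE mulrA. Qed.

Lemma dotNl u v : dot (- u) v = - dot u v.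
Proof. by rewrite -scaleN1r dotZl mulN1r. Qed.

Lemma dotDr u v w : dot w (u + v) = dot w u + dot w v.
Proof. by rewrite dotC dotDl !(dotC w). Qed.

Lemma dotZr a u v : dot v (a *: u) = a * dot v u.
Proof. by rewrite dotC dotZl dotC. Qed.

Lemma dotNr u v : dot v (- u) = - dot v u.
Proof. by rewrite dotC dotNl dotC. Qed.

Lemma dot_ge0 u : 0 <= dot u u.
Proof. by apply: sumr_ge0 => i _; rewrite -expr2 sqr_ge0. Qed.

Lemma dot_eq0 u : (dot u u == 0) = (u == 0).
Proof.
apply/eqP/eqP => [|->]; last by rewrite -(scale0r 0) dotZl mul0r.
move/psumr_eq0P => u0; apply/rowP => i; rewrite mxE; apply/eqP.
rewrite -sqrf_eq0 expr2; apply/eqP/u0 => // j _.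
by rewrite -expr2 sqr_ge0.
Qed.

Lemma dot_gt0 u : (0 < dot u u) = (u != 0).
Proof. by rewrite lt0r dot_ge0 andbT dot_eq0. Qed.

Lemma dot0l u : dot 0 u = 0.
Proof. by rewrite -(scale0r 0) dotZl mul0r. Qed.

Lemma enorm_sqr u : enorm u ^+ 2 = dot u u.
Proof. by rewrite sqr_sqrtr// dot_ge0. Qed.

(** Testing minimality against [v] itself, where the penalty vanishes, forces the squared distance
    from [p] to [v] to be 0. *)
Lemma prox0 (mu : R) v p : 0 < mu -> prox mu (fun=> 0%E) v p <-> p = v.
Proof.
move=> mu0; split=> [/(_ v)|-> q]; rewrite !add0e !lee_fin !enorm_sqr subrr.
  rewrite dot0l mulr0 pmulr_rle0 ?invr_gt0 ?mulr_gt0// => le0.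
  by apply/eqP; rewrite -subr_eq0 -dot_eq0 eq_le le0 dot_ge0.
by rewrite dot0l mulr0 mulr_ge0 ?dot_ge0// invr_ge0 mulr_ge0// ltW.
Qed.

(** The differential is linear, so expanding [v] in the standard basis reduces the claim to the
    partial derivatives that define [grad]. *)
Lemma derive_grad (g : 'rV[R]_n -> R) x v :
  differentiable g x -> 'D_v g x = dot (grad g x) v.
Proof.
move=> dg; rewrite deriveE// [in LHS](row_sum_delta v) linear_sum.
by apply: eq_bigr => i _; rewrite linearZ mxE /= deriveE// mulrC.
Qed.

End Dot.

(** * Largest points of geometric grids *)

Section Grid.
Context {R : realType}.
Implicit Types (a b r : R) (A Q : set R).

Lemma is_largest_unique A a b : is_largest A a -> is_largest A b -> a = b.
Proof.
by move=> [Aa ua] [Ab ub]; apply/eqP; rewrite eq_le ua// ub.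
Qed.

Lemma geometric_grid_gt0 a r b :
  0 < a -> 0 < r -> geometric_grid a r b -> 0 < b.
Proof. by move=> a0 r0 [i _ <-]; rewrite mulr_gt0// exprn_gt0. Qed.

(** The grid decreases in the exponent, so the least exponent satisfying [Q] gives the largest
    point. *)
Lemma is_largest_grid a r Q : 0 < a -> in01 r ->
  (exists b, geometric_grid a r b /\ Q b) ->
  exists b, is_largest [set b | geometric_grid a r b /\ Q b] b.
Proof.
move=> a0 /andP[r0 r1] [_ [[i0 _ <-] Qi0]].
have exQ : exists i, `[< Q (a * r ^+ i) >] by exists i0; apply/asboolP.
case: (ex_minnP exQ) => i /asboolP Qi mini.
exists (a * r ^+ i); split=> [|_ [[j _ <-] Qj]].
  by split=> //; exists i.
rewrite ler_pM2l//; apply: ler_wiXn2l; [exact: ltW|exact: ltW|].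
by apply: mini; apply/asboolP.
Qed.

Lemma is_largest_grid_start r Q : in01 r -> Q 1 ->
  is_largest [set b | geometric_grid 1 r b /\ Q b] 1.
Proof.
move=> /andP[r0 r1] Q1; split.
  by split=> //; exists 0%N; rewrite ?mul1r.
by move=> _ [[i _ <-] _]; rewrite mul1r exprn_ile1// ltW.
Qed.

Lemma geometric_grid_small a r e : 0 < a -> in01 r -> 0 < e ->
  exists2 b, geometric_grid a r b & b < e.
Proof.
move=> a0 /andP[r0 r1] e0.
have r1' : `|r| < 1 by rewrite gtr0_norm.
have /cvgrPdist_lt/(_ e e0)[N _ HN] := cvg_geometric a r1'.
exists (a * r ^+ N); first by exists N.
have := HN N (leqnn N).
by rewrite sub0r normrN /= gtr0_norm// mulr_gt0// exprn_gt0.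
Qed.

End Grid.

(** * Descent along the negative gradient, and curvature along a step *)

Section GradientStep.
Context {R : realType} {n : nat}.
Variable g : 'rV[R]_n -> R.

(** Along [- grad g x] the derivative is minus the squared norm of the gradient. Claiming only half
    of it leaves, at a noncritical point, a strict margin that absorbs the error of the difference
    quotient for short steps. *)
Lemma gradient_decrease (x : 'rV[R]_n) : differentiable g x ->
  exists2 e, 0 < e & forall t, 0 < t < e ->
    g (x - t *: grad g x) <= g x - t / 2 * dot (grad g x) (grad g x).
Proof.
move=> dg; have [G0|G0] := eqVneq (grad g x) 0.
  exists 1 => // t _; rewrite G0 scaler0 subr0.
  by rewrite dot0l mulr0 subr0.
set G := grad g x in G0 *; set a := dot G G.
have a0 : 0 < a by rewrite dot_gt0.
have gv : 'D_(- G) g x < - (a / 2).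
  by rewrite derive_grad// dotNr -/G -/a; lra.
(* The tolerance is exactly the margin between the derivative and [- (a / 2)]. *)
have /cvgrPdist_lt/(_ (- (a / 2) - 'D_(- G) g x)) :
    h^-1 *: (g (h *: - G + x) - g x) @[h --> 0^'] --> 'D_(- G) g x.
  exact: diff_derivable.
rewrite subr_gt0 => /(_ gv)[e /= e0 He].
exists e => // t /andP[t0 te].
have := He t; rewrite /= sub0r normrN gtr0_norm// => /(_ te).
move/(_ (lt0r_neq0 t0)); rewrite distrC => /ltr_normlW; rewrite ltrD2r => lt.
have : t^-1 * (g (x - t *: G) - g x) <= - (a / 2).
  by rewrite [x - _]addrC -scalerN ltW.
by rewrite mulrC ler_pdivrMr// => le; lra.
Qed.

(** Strong convexity between [x + a *: d] and [x] has a factor [a ^+ 2] on the left and [a] on the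
    right; one [a] cancels. *)
Lemma strongly_convex_step (m a : R) (x d : 'rV[R]_n) :
  strongly_convex m g -> 0 < a ->
  m * a * dot d d <= dot d (grad g (x + a *: d) - grad g x).
Proof.
move=> /(_ (x + a *: d) x) + a0; rewrite addrAC subrr add0r enorm_sqr.
rewrite dotZl !dotZr mulrCA ler_pM2l//.
by rewrite mulrA [dot d (_ - _)]dotC; apply.
Qed.

(* The two correction terms cancel whatever their common denominator is, even
   0 (where division returns 0); so (B) at t = 1 needs no curvature bound. *)
Lemma dot_hs_direction x d j :
  dot (grad g (x j)) (hs_direction g x d j) =
  - dot (grad g (x j)) (grad g (x j)).
Proof.
case: j => [|j] /=; first by rewrite dotNr.
by set y := grad g (x j.+1) - _; rewrite !(dotDr, dotNr, dotZr); ring.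
Qed.

End GradientStep.

(** * The steps of the algorithm when h = 0 *)

Section SmoothPNCG.
Context {R : realType} {n : nat}.
Variables (g : 'rV[R]_n -> R) (P : params R).
Implicit Types (r : trace R n) (k : nat).

Local Notation h := (fun=> 0%E : \bar R).

Lemma eta_gradient_step r k : 0 < iter_mu r k ->
  iter_xplus r k = iter_x r k - iter_mu r k *: grad g (iter_x r k) ->
  eta_ r k = grad g (iter_x r k).
Proof.
move=> mu0; rewrite /eta_ => ->.
by rewrite addrAC subrr add0r scalerN opprK scalerA mulVf ?scale1r// gt_eqF.
Qed.

Lemma step1_eta r k : 0 < mu_prev P r k -> in01 (kappa P) ->
  step1 g h P r k -> 0 < iter_mu r k /\ eta_ r k = grad g (iter_x r k).
Proof.
move=> m0 /andP[k0 _] [[[gk _] _] [xpE _]].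
have mu0 := geometric_grid_gt0 m0 k0 gk.
by split=> //; apply: eta_gradient_step => //; apply: (prox0 _ _ mu0).1.
Qed.

(** The grid tends to 0, so it has a point below the threshold of [gradient_decrease]; that point is
    accepted, hence a largest accepted one exists. *)
Lemma step1_mu_exists r k (m : R) : differentiable g (iter_x r k) ->
  0 < m -> in01 (kappa P) ->
  exists mu, is_largest [set m' | geometric_grid m (kappa P) m' /\
                                  exists p, step1_accepts g h r k m' p] mu.
Proof.
move=> dg m0 k01; apply: is_largest_grid => //.
have [e e0 He] := gradient_decrease dg.
have [mu gmu mue] := geometric_grid_small m0 k01 e0.
have mu0 : 0 < mu by apply: geometric_grid_gt0 gmu => //; case/andP: k01.
exists mu; split=> //; set x := iter_x r k in dg He *.
exists (x - mu *: grad g x); split; first exact: (prox0 _ _ mu0).2.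
have : 0 < mu < e by rewrite mu0.
move=> /He /le_trans; apply; rewrite [x - _ - x]addrAC subrr add0r enorm_sqr.
rewrite dotNr dotNl dotNr opprK !dotZl !dotZr.
(* For the gradient step the quadratic model equals [g x - mu * a + mu / 2 * a], which is exactly
   the bound of [gradient_decrease]. *)
set a := dot _ _; rewrite le_eqVlt; apply/orP; left; apply/eqP; field.
by rewrite gt_eqF.
Qed.

(** Induction is needed because the grid for [iter_mu r k] starts at the previous value, whose
    positivity must already be known. *)
Lemma pncg_eta x0 r k : admissible P -> pncg_run g h P r x0 -> reached r k ->
  0 < iter_mu r k /\ eta_ r k = grad g (iter_x r k).
Proof.
move=> /and5P[mu0 k01 _ _ _] [_ _ s1 _].
elim: k => [|k IH] rk; first exact: (step1_eta (k := 0%N) mu0 k01 (s1 _ rk)).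
have /IH[muk _] : reached r k by move=> j /ltnW; apply: rk.
exact: (step1_eta (k := k.+1) muk k01 (s1 _ rk)).
Qed.

Section Gradients.
Variables (m : R) (r : trace R n) (k : nat).
Hypotheses (hconv : strongly_convex m g) (hnu : nubar P <= m).
Hypotheses (etak : eta_ r k = grad g (iter_x r k)).

Lemma nu_eq0 : eta_ r k.+1 = grad g (iter_x r k.+1) -> nu_ P r k.+1 = 0.
Proof.
move=> etaS; rewrite /nu_ /= ifT// /s_ /y_ etak etaS.
rewrite dotC; apply: le_trans (hconv _ _).
by rewrite ler_wpM2r// sqr_ge0.
Qed.

Lemma z_eq_y : eta_ r k.+1 = grad g (iter_x r k.+1) -> z_ P r k = y_ r k.
Proof. by move=> etaS; rewrite /z_ nu_eq0// scale0r addr0. Qed.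

Lemma condB_1 : bigT P <= 1 ->
  iter_dir r k = hs_direction g (iter_x r) (iter_d r) k -> condB g h P r k 1.
Proof.
move=> hT dirE; rewrite /condB adde0 sube0 lee_fin !mul1r dirE.
rewrite dot_hs_direction etak enorm_sqr lerN2.
by rewrite ler_piMl// dot_ge0.
Qed.

Lemma armijo_smooth a : armijo g h P r k a <->
  g (iter_x r k + a *: iter_d r k) <=
  g (iter_x r k) + delta P * a * dot (grad g (iter_x r k)) (iter_d r k).
Proof. by rewrite /armijo /objective !adde0 -EFinD lee_fin etak. Qed.

Lemma is_largest_armijo_smooth b a :
  is_largest [set c | geometric_grid b (tau P) c /\ armijo g h P r k c] a <->
  is_largest [set c | geometric_grid b (tau P) c /\
    g (iter_x r k + c *: iter_d r k) <=
    g (iter_x r k) + delta P * c * dot (grad g (iter_x r k)) (iter_d r k)] a.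
Proof.
by under eq_set do rewrite (propext (armijo_smooth _)).
Qed.

Lemma selects_step41_1 : admissible P -> bigT P <= 1 ->
  iter_dir r k = hs_direction g (iter_x r) (iter_d r) k ->
  selects_step41 g h P r k 1.
Proof.
move=> /and5P[_ _ _ th /and4P[/andP[_ tb1] _ _ _]] hT dirE; split=> //.
by apply: is_largest_grid_start => //; apply: condB_1.
Qed.

End Gradients.

(** An equivalence, so that it both extracts the direction from a run and certifies Step 3 for a
    trace built from a Hestenes-Stiefel run. *)
Lemma step3_smooth m r k : strongly_convex m g -> nubar P <= m ->
  (forall j, (j <= k)%N -> eta_ r j = grad g (iter_x r j)) ->
  step3 P r k <-> iter_dir r k = hs_direction g (iter_x r) (iter_d r) k.
Proof.
move=> hconv hnu; rewrite /step3; case: k => [|k] etaE /=.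
  by rewrite etaE.
have etak := etaE k (leqnSn k).
rewrite /beta_ /gamma_ /= (z_eq_y hconv hnu etak) ?etaE//.
by rewrite /y_ !etaE.
Qed.

Lemma pncg_continues m x0 r k : strongly_convex m g -> admissible P ->
  nubar P <= m -> bigT P <= 1 -> pncg_run g h P r x0 -> continues r k ->
  [/\ iter_dir r k = hs_direction g (iter_x r) (iter_d r) k,
      selects_step41 g h P r k 1 & step41 g h P r k 1].
Proof.
move=> hconv hP hnu hT run ck; have [_ _ _ /(_ _ ck) [s3 s4]] := run.
have etaE j : (j <= k)%N -> eta_ r j = grad g (iter_x r j).
  move=> jk; have [//|_ ->//] := pncg_eta (k := j) hP run.
  by move=> i ij; apply: ck.1; apply: leq_trans jk.
have dirE := (step3_smooth hconv hnu etaE).1 s3.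
have sel := selects_step41_1 (etaE k (leqnn k)) hP hT dirE.
(* Largest points are unique, so Step 4.1 can only start from 1; Step 4.2 is excluded because 1 is
   selected. *)
split=> //; case: s4 => [[t [lt _] s41]|[nosel _]].
  by rewrite (is_largest_unique sel.1 lt).
by exfalso; apply: nosel; exists 1.
Qed.

(** Ensures that the quotients in the Hestenes-Stiefel formula are genuine divisions: the step
    length is positive and the direction nonzero, so strong convexity makes the denominator
    positive. *)
Lemma pncg_curvature m x0 r k : 0 < m -> strongly_convex m g -> admissible P ->
  nubar P <= m -> bigT P <= 1 -> pncg_run g h P r x0 -> continues r k ->
  0 < dot (iter_d r k) (grad g (iter_x r k.+1) - grad g (iter_x r k)).
Proof.
move=> m0 hconv hP hnu hT run ck.
have [dirE _ [dE [[ga _] _] xS]] := pncg_continues hconv hP hnu hT run ck.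
have [_ etak] := pncg_eta hP run ck.1.
have a0 : 0 < iter_alpha r k.
  apply: geometric_grid_gt0 ga => //.
  by case/and5P: hP => _ _ _ _ /and4P[_ /andP[]].
rewrite xS; apply: lt_le_trans (strongly_convex_step _ _ hconv a0).
rewrite !mulr_gt0// dot_gt0 dE dirE; apply/eqP => d0.
(* A zero direction would make the squared norm of the gradient 0, against [continues]. *)
have := dot_hs_direction g (iter_x r) (iter_d r) k; rewrite d0 dotC dot0l.
by move/esym/eqP; rewrite oppr_eq0 dot_eq0 -etak; apply/negP; case: ck.
Qed.

(** * Translation between runs of the two methods *)

Lemma pncg_run_hs_run m x0 r : strongly_convex m g -> admissible P ->
  nubar P <= m -> bigT P <= 1 -> pncg_run g h P r x0 ->
  hs_run g (delta P) (tau P) x0 (iter_x r) (iter_d r) (iter_alpha r).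
Proof.
move=> hconv hP hnu hT run; split; first by case: run.
move=> k gk.
(* Nonzero gradients become nonzero [eta_] only at indices already reached, hence the induction on
   [j]. *)
have rk j : (j <= k)%N -> reached r j.
  elim: j => [_ i //|j IH jk i]; rewrite ltnS leq_eqVlt => /predU1P[->|ij].
    have [_ ->] := pncg_eta hP run (IH (ltnW jk)).
    exact: gk (ltnW jk).
  exact: IH (ltnW jk) _ ij.
have [_ etak] := pncg_eta hP run (rk k (leqnn k)).
have ck : continues r k by split; [exact: rk|rewrite etak gk].
have [dirE _ [dE lgst xS]] := pncg_continues hconv hP hnu hT run ck.
by split=> //; [rewrite dE|apply/is_largest_armijo_smooth].
Qed.

(** A Hestenes-Stiefel run lacks only the data of Step 1; the values mu_k are built recursively by
    backtracking, and the points of [iter_xplus] are the gradient steps. *)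
Lemma hs_run_pncg_run m x0 x d alpha : (forall x, differentiable g x) ->
  strongly_convex m g -> admissible P -> nubar P <= m -> bigT P <= 1 ->
  hs_run g (delta P) (tau P) x0 x d alpha ->
  exists r, [/\ pncg_run g h P r x0, iter_x r = x, iter_d r = d
               & iter_alpha r = alpha].
Proof.
move=> dg hconv hP hnu hT [x00 hs].
have [mu00 k01 _ _ _] := and5P hP.
(* A placeholder: [step1_accepts] reads only the iterates of a trace, so mu can be chosen before the
   real trace exists. *)
pose r0 := Trace x (fun=> 0) x d d alpha.
(* [F] maps an index and the previous mu to the next one; the positivity guard makes it total, with
   0 as default. *)
have /choice[F FP] : forall km : nat * R, exists mu, 0 < km.2 ->
    is_largest [set m' | geometric_grid km.2 (kappa P) m' /\
                         exists p, step1_accepts g h r0 km.1 m' p] mu.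
  move=> [k m']; have [m0|m0] := ltP 0 m'; last by exists 0.
  by have [mu] := step1_mu_exists (r := r0) (k := k) (dg _) m0 k01; exists mu.
pose mus := fix mus k := F (k, if k is j.+1 then mus j else mu_init P).
(* Both direction fields are [d], since Step 4.1 leaves the direction of Step 3 unchanged. *)
pose r := Trace x mus (fun k => x k - mus k *: grad g (x k)) d d alpha.
have musE k : mus k = F (k, mu_prev P r k) by case: k.
have prev0 k : 0 < mu_prev P r k.
  elim: k => [//|k IH]; rewrite /= musE.
  have [[gk _] _] := FP (k, _) IH; apply: geometric_grid_gt0 gk => //.
  by case/andP: k01.
have lgst k : is_largest [set m' | geometric_grid (mu_prev P r k) (kappa P) m' /\
                          exists p, step1_accepts g h r k m' p] (mus k).
  by rewrite musE; exact: (FP (k, _) (prev0 k)).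
have mus0 k : 0 < mus k by exact: (prev0 k.+1).
have etaE k : eta_ r k = grad g (x k).
  exact: (eta_gradient_step (r := r) (mus0 k)).
exists r; split=> //; split=> [|//|k _|k [rk ek]].
- by rewrite /objective adde0 ltry.
- split; first exact: lgst.
  (* The accepted [p] must be the gradient step stored in [r], because the prox set is a
     singleton. *)
  have [[_ [p acc]] _] := lgst k.
  by have pE := (prox0 _ _ (mus0 k)).1 acc.1; rewrite pE in acc.
have [dE la xS] : [/\ d k = hs_direction g x d k, is_largest
          [set a | geometric_grid 1 (tau P) a /\
                   g (x k + a *: d k) <=
                   g (x k) + delta P * a * dot (grad g (x k)) (d k)]
          (alpha k) & x k.+1 = x k + alpha k *: d k].
  (* [hs_run] asks for nonzero gradients up to and including [k]: [reached] covers the indices below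
     [k], and passing Step 2 covers [k]. *)
  apply: hs => j; rewrite leq_eqVlt => /predU1P[->|jk]; rewrite -etaE//.
  exact: rk.
split; first by apply/(step3_smooth hconv hnu).
left; exists 1; first exact: selects_step41_1.
by split=> //; apply/is_largest_armijo_smooth.
Qed.

End SmoothPNCG.

Theorem mainTheorem5 (R : realType) (n : nat) (g : 'rV[R]_n -> R) (m : R)
    (P : params R) (x0 : 'rV[R]_n)
    (hm : 0 < m)
    (hg : continuously_differentiable g)
    (hconv : strongly_convex m g)
    (hP : admissible P)
    (hnu : nubar P <= m)
    (hT : bigT P <= 1) :
  let h : 'rV[R]_n -> \bar R := fun=> 0%E in
  (forall (x d : nat -> 'rV[R]_n) (alpha : nat -> R),
     (exists r : trace R n,
        [/\ pncg_run g h P r x0, iter_x r = x, iter_d r = d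
          & iter_alpha r = alpha])
     <-> hs_run g (delta P) (tau P) x0 x d alpha) /\
  (forall r : trace R n, pncg_run g h P r x0 ->
     let x := iter_x r in
     let d := iter_d r in
     [/\ forall k, reached r k -> eta_ r k = grad g (x k),
         forall k, continues r k.+1 ->
           [/\ nu_ P r k.+1 = 0,
               z_ P r k = y_ r k,
               y_ r k = grad g (x k.+1) - grad g (x k),
               dot (d k) (y_ r k) != 0 &
               d k.+1 = - grad g (x k.+1)
                 + (dot (grad g (x k.+1)) (y_ r k) / dot (d k) (y_ r k)) *: d k
                 - (dot (grad g (x k.+1)) (d k) / dot (d k) (y_ r k)) *: y_ r k]
       & forall k, continues r k ->
           [/\ condB g h P r k 1, selects_step41 g h P r k 1
             & step41 g h P r k 1]]).
Proof.
split=> [x d alpha|r run x d].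
  split=> [[r [run <- <- <-]]|]; first exact: pncg_run_hs_run run.
  exact: (hs_run_pncg_run hg.1).
have etaE k : reached r k -> eta_ r k = grad g (x k).
  by move=> rk; have [] := pncg_eta hP run rk.
have run_ck := pncg_continues hconv hP hnu hT run.
split=> // k ck; last first.
  have [dirE sel s41] := run_ck k ck.
  by split=> //; apply: condB_1 => //; apply: etaE; case: ck.
have ck' : continues r k.
  by split=> [j jk|]; [apply: ck.1; exact: ltnW|exact: ck.1].
have [etak etaS] := (etaE k ck'.1, etaE k.+1 ck.1).
have yE : y_ r k = grad g (x k.+1) - grad g (x k) by rewrite /y_ etak etaS.
split=> //; [exact: (nu_eq0 hconv)|exact: (z_eq_y hconv)| |].
  by rewrite yE gt_eqF// (pncg_curvature hm hconv hP hnu hT run).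
by have [dirE _ [dE _ _]] := run_ck k.+1 ck; rewrite yE /d dE dirE.
Qed.
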